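(* Let $r,p,n$ be positive integers with $p\mid r$, $d:=r/p$, $H:=G(r,p,n)$. The set $$\{\mathbf{x}_\gamma+\mathcal{I}_H:\gamma\in\Gamma\}$$ is a basis for the coinvariant space $\mathbb{C}[\mathbf{x}]_H$.
   Context: $G(r,n)=\mathbb{Z}_r\wr S_n$ is the set of pairs $((c_1,\dots,c_n),\sigma)$ with $c_i\in\{0,\dots,r-1\}$, $\sigma\in S_n$, acting on $\mathbb{C}[\mathbf{x}]=\mathbb{C}[x_1,\dots,x_n]$ by $((c_i),\sigma)\cdot P(x_1,\dots,x_n)=P(\zeta^{c_{\sigma(1)}}x_{\sigma(1)},\dots,\zeta^{c_{\sigma(n)}}x_{\sigma(n)})$, $\zeta$ a primitive $r$-th root of unity. $H=G(r,p,n)$ is the subgroup of those elements with $\sum_i c_i\equiv 0\bmod p$. $\mathcal{I}_H$ is the ideal of $\mathbb{C}[\mathbf{x}]$ generated by the basic $H$-invariants $\vartheta_j=e_j(x_1^r,\dots,x_n^r)$ for $1\le j\le n-1$ ($e_j$ the elementary symmetric polynomial) and $\vartheta_n=x_1^d\cdots x_n^d$; $\mathbb{C}[\mathbf{x}]_H=\mathbb{C}[\mathbf{x}]/\mathcal{I}_H$. $\Gamma=\{\gamma=((c_1,\dots,c_n),\sigma)\in G(r,n):c_n<d\}$. Write $\gamma_i=\sigma(i)^{c_i}$ (the integer $\sigma(i)$ with color $c_i$). Colored integers are totally ordered by $j^{c}\prec k^{c'}$ iff $c>c'$, or $c=c'$ and $j<k$. $\mathrm{Des}(\gamma)=\{i\in\{1,\dots,n-1\}:\gamma_i\succ\gamma_{i+1}\}$,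 $d_i(\gamma)=|\{j\in\mathrm{Des}(\gamma):j\ge i\}|$, $f_i(\gamma)=r\,d_i(\gamma)+c_i$, and $\mathbf{x}_\gamma=\prod_{i=1}^n x_{\sigma(i)}^{f_i(\gamma)}$. *)

(* Defs.v *)
From HB Require Import structures.
From mathcomp Require Import all_boot all_order all_fingroup all_algebra.
From mathcomp Require Import generic_quotient ring_quotient complex boolp reals.
From mathcomp Require Import mpoly.

Set Implicit Arguments.
Unset Strict Implicit.
Unset Printing Implicit Defensive.

Import GRing.Theory.
Local Open Scope ring_scope.
Local Open Scope quotient_scope.

Section Basis.
Variables (K : fieldType) (V : lmodType K) (I : finType).

(* {vspace V} and basis_of need V to be finite dimensional, which is not known
   a priori for a quotient of a polynomial ring. The family (b i) is indexed by
   A, so being a basis includes that b is injective on A. *)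
Definition lin_indep (A : {set I}) (b : I -> V) : Prop :=
  forall a : I -> K,
    \sum_(i in A) a i *: b i = 0 -> forall i, i \in A -> a i = 0.

Definition spans (A : {set I}) (b : I -> V) : Prop :=
  forall v : V, exists a : I -> K, v = \sum_(i in A) a i *: b i.

Definition is_basis (A : {set I}) (b : I -> V) : Prop :=
  lin_indep A b /\ spans A b.

End Basis.

Section ColoredPermutations.

(* ((c_1, ..., c_n), sigma); positions and values are indexed by 'I_n, hence
   shifted down by one, which is harmless for all comparisons below. *)
Definition colored_perm (r n : nat) : Type :=
  ({ffun 'I_n -> 'I_r} * {perm 'I_n})%type.

HB.instance Definition _ (r n : nat) := Finite.on (colored_perm r n).

Variables (r p n : nat).
Implicit Types (g : colored_perm r n) (i : 'I_n).

Definition color g i : 'I_r := g.1 i.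
Definition perm_of g : {perm 'I_n} := g.2.

Definition Grpn : {set colored_perm r n} :=
  [set g | (p %| \sum_i color g i)%N].

Definition Gamma : {set colored_perm r n} :=
  [set g | [forall i : 'I_n, (i.+1 == n) ==> (color g i < r %/ p)%N]].

(* The pair (j, c) stands for the colored integer j^c. *)
Definition prec (u v : 'I_n * 'I_r) : bool :=
  (v.2 < u.2)%N || (u.2 == v.2) && (u.1 < v.1)%N.

Definition letter g i : 'I_n * 'I_r := (perm_of g i, color g i).

Definition Des g : {set 'I_n} :=
  [set i : 'I_n |
    [exists k : 'I_n, (k == i.+1 :> nat) && prec (letter g k) (letter g i)]].

Definition descnum g i : nat := #|[set j : 'I_n in Des g | (i <= j)%N]|.

Definition fexp g i : nat := (r * descnum g i + color g i)%N.

End ColoredPermutations.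

Section Coinvariants.
Variables (K : fieldType) (r p n : nat).
Local Notation P := {mpoly K[n]}.
Local Notation d := (r %/ p)%N.

Definition xmon (g : colored_perm r n) : P :=
  \prod_(i < n) 'X_(perm_of g i) ^+ fexp g i.

(* theta j is the basic invariant with index j + 1. *)
Definition theta (j : 'I_n) : P :=
  if (j.+1 < n)%N then mesym n K j.+1 \mPo [tuple 'X_i ^+ r | i < n]
  else \prod_(i < n) 'X_i ^+ d.

Definition cact (z : K) (g : colored_perm r n) (f : P) : P :=
  f \mPo [tuple z ^+ color g (perm_of g i) *: 'X_(perm_of g i) | i < n].

Definition ideal_H : {pred P} :=
  fun f => `[< exists h : 'I_n -> P, f = \sum_(j < n) h j * theta j >].

Lemma ideal_HP (f : P) :
  reflect (exists h : 'I_n -> P, f = \sum_(j < n) h j * theta j)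
          (f \in ideal_H).
Proof. exact: asboolP. Qed.

Lemma ideal_HM (a f : P) : f \in ideal_H -> a * f \in ideal_H.
Proof.
case/ideal_HP=> h ->; apply/ideal_HP; exists (fun j => a * h j).
by rewrite mulr_sumr; apply: eq_bigr => j _; rewrite mulrA.
Qed.

Lemma ideal_H_zmod_closed : zmod_closed ideal_H.
Proof.
split=> [|_ _ /ideal_HP[h ->] /ideal_HP[k ->]]; apply/ideal_HP.
  by exists (fun=> 0); rewrite big1 // => j _; rewrite mul0r.
exists (fun j => h j - k j); rewrite -sumrB.
by apply: eq_bigr => j _; rewrite mulrBl.
Qed.

HB.instance Definition _ :=
  GRing.isZmodClosed.Build P ideal_H ideal_H_zmod_closed.

Definition coinvariant : Type := {ideal_quot ideal_H}.

HB.instance Definition _ := GRing.Zmodule.on coinvariant.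

Definition coset_H (f : P) : coinvariant := \pi_{ideal_quot ideal_H} f.

Lemma coset_H_eq (f g : P) : coset_H f = coset_H g <-> f - g \in ideal_H.
Proof. by rewrite Quotient.idealrBE; split=> /eqP. Qed.

Lemma coset_HK (v : coinvariant) : coset_H (repr (v : {ideal_quot ideal_H})) = v.
Proof. exact: reprK. Qed.

Lemma coset_HD (f g : P) : coset_H (f + g) = coset_H f + coset_H g.
Proof. exact: raddfD. Qed.

Definition coscale (c : K) (v : coinvariant) : coinvariant :=
  coset_H (c *: repr (v : {ideal_quot ideal_H})).

Lemma coscaleE (c : K) (f : P) : coscale c (coset_H f) = coset_H (c *: f).
Proof.
apply/coset_H_eq; rewrite -scalerBr -mul_mpolyC; apply: ideal_HM.
exact/coset_H_eq/coset_HK.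
Qed.

Lemma coscaleA a b v : coscale a (coscale b v) = coscale (a * b) v.
Proof. by rewrite -(coset_HK v) !coscaleE scalerA. Qed.

Lemma coscale1 : left_id 1 coscale.
Proof. by move=> v; rewrite -(coset_HK v) coscaleE scale1r. Qed.

Lemma coscaleDr : right_distributive coscale +%R.
Proof.
move=> a u v; rewrite -(coset_HK u) -(coset_HK v) -coset_HD !coscaleE.
by rewrite scalerDr coset_HD.
Qed.

Lemma coscaleDl v : {morph coscale^~ v : a b / a + b}.
Proof.
by move=> a b; rewrite -(coset_HK v) !coscaleE scalerDl coset_HD.
Qed.

HB.instance Definition _ :=
  GRing.Zmodule_isLmodule.Build K coinvariant
    coscaleA coscale1 coscaleDr coscaleDl.

Lemma comp_mpoly_comp (f : P) (t u : n.-tuple P) :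
  (f \mPo t) \mPo u = f \mPo [tuple tnth t i \mPo u | i < n].
Proof.
rewrite (comp_mpolyEX f t) (comp_mpolyEX f) raddf_sum /=; apply: eq_bigr => m _.
rewrite comp_mpolyZ; congr (_ *: _); rewrite !comp_mpolyX rmorph_prod /=.
by apply: eq_bigr => i _; rewrite rmorphXn tnth_mktuple.
Qed.

(* The generators of ideal_H are indeed invariant under H = G(r,p,n). *)
Lemma theta_invariant (z : K) (g : colored_perm r n) (j : 'I_n) :
  (p %| r)%N -> r.-primitive_root z -> g \in Grpn r p n ->
  cact z g (theta j) = theta j.
Proof.
move=> pr z_prim; rewrite inE => gH; rewrite /cact /theta.
set t := [tuple _ | _ < _].
have tE i : 'X_i \mPo t = z ^+ color g (perm_of g i) *: 'X_(perm_of g i).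
  by rewrite comp_mpolyXU -tnth_nth tnth_mktuple.
case: ifP => _.
  rewrite comp_mpoly_comp; set s := perm_of g; set u := [tuple 'X_i ^+ r | i < n].
  rewrite -[in RHS](issymP _ (mesym_sym _ _ j.+1) s) msym_mPo.
  congr (_ \mPo _); apply: eq_mktuple => i.
  rewrite !tnth_mktuple rmorphXn /= tE exprZn -exprM mulnC exprM.
  by rewrite (prim_expr_order z_prim) expr1n scale1r.
rewrite rmorph_prod /=.
transitivity (\prod_(i < n) (z ^+ color g (perm_of g i)) ^+ d *:
              \prod_(i < n) ('X_(perm_of g i) ^+ d : P)).
  rewrite -scaler_prod; apply: eq_bigr => i _.
  by rewrite rmorphXn /= tE exprZn.
have -> : \prod_(i < n) ('X_(perm_of g i) ^+ d : P) = \prod_(i < n) 'X_i ^+ d.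
  by rewrite [RHS](reindex_inj (@perm_inj _ (perm_of g))).
have -> : \prod_(i < n) (z ^+ color g (perm_of g i)) ^+ d
          = \prod_(i < n) (z ^+ color g i) ^+ d.
  by rewrite [RHS](reindex_inj (@perm_inj _ (perm_of g))).
rewrite prodrXl -expr_sum -exprM.
case/dvdnP: gH => q ->; rewrite -mulnA (mulnC p) divnK // mulnC exprM.
by rewrite (prim_expr_order z_prim) expr1n scale1r.
Qed.

End Coinvariants.

(* Main.v *)
From HB Require Import structures.
Require Import Defs.
From mathcomp Require Import all_boot all_order all_fingroup all_algebra.
From mathcomp Require Import complex reals mpoly ssrcomplements boolp zify.

Set Implicit Arguments.
Unset Strict Implicit.
Unset Printing Implicit Defensive.

Import Defs GRing.Theory.
Local Open Scope ring_scope.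

(** The monomials [x_gamma] are a basis of the coinvariants because [C[x]] is a
    free module over [C[theta_1, ..., theta_n]] with basis the [x_gamma], for
    [gamma] in [Gamma]; reducing modulo the [theta_j] then leaves exactly the
    [x_gamma]. Freeness means that the products
    [x_gamma theta_1^v_1 ... theta_n^v_n] form a vector space basis of [C[x]].
    This is proved by a triangularity argument.

    Let [gamma = (c, sigma)]. The exponents of [x_gamma] decrease weakly along
    [sigma], and equal exponents occur at increasing indices. Multiplying by the
    elementary symmetric function [theta_j] of the powers of the variables, the
    natural leading term is obtained by raising the exponents of the first [j]
    variables [x_(sigma 1), ..., x_(sigma j)]. So the product above has a leading
    exponent [lead gamma v], again sorted by [sigma], and [lead] is a bijection
    from [Gamma] times the exponent vectors to the exponent vectors ([lead_inj],
    [lead_surj]): [sigma] is found by sorting, and the other data by Euclidean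
    division by [d] and by [r] and by taking consecutive differences.

    To see that the other terms are smaller ([descent_prod_lead]), replace an
    exponent vector [a] by its keys [n a_i + (n - 1 - i)], which are pairwise
    distinct and sorted by the same [sigma]. Every other exponent [b] of the
    product is dominated by [lead gamma v]: for all [k], no [k] keys of [b] have
    a larger sum than the [k] largest keys of [lead gamma v]. This condition
    survives multiplication by each [theta_j]. Let the [weight] of an
    exponent vector be the sum over [k] of its largest sums of [k] keys. As a key
    determines its index modulo [n], two different vectors of equal weight cannot
    dominate each other, so [b] has smaller weight ([dominated_weight]).

    Hence the linear endomorphism of [C[x]] sending the monomial with exponent
    [lead gamma v] to the product indexed by [(gamma, v)] is bijective
    ([expand_inj], [expand_surj]). Under it, multiplication by [theta_j]
    corresponds to a shift of exponents ([theta_expand]) whose image misses the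
    exponents of the [x_gamma]. So no nontrivial combination of the [x_gamma]
    lies in the ideal, while all products with [v] nonzero do. *)

(** * Triangular changes of basis *)

Section Expand.
Variables (K : fieldType) (n : nat).
Local Notation P := {mpoly K[n]}.
Implicit Types (B : 'X_{1..n} -> P) (f g : P) (a b m : 'X_{1..n}).

(** The linear map sending each monomial ['X_[m]] to [B m]. *)
Definition expand B f : P := \sum_(m <- msupp f) f@_m *: B m.

(** A range of summation that does not depend on [f], so that linearity can be
    checked coefficient by coefficient. *)
Lemma expand_bounded k B f : (msize f <= k)%N ->
  expand B f = \sum_(m : 'X_{1..n < k}) f@_m *: B m.
Proof.
move=> le_fk; rewrite /expand (big_mksub 'X_{1..n < k}) ?msupp_uniq //=.
  by rewrite big_rmcond //= => m /memN_msupp_eq0 ->; rewrite scale0r.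
by move=> m /msize_mdeg_lt /leq_trans; apply.
Qed.

Lemma expand_linear B : linear (expand B).
Proof.
move=> c f g; pose k := maxn (msize (c *: f + g)) (maxn (msize f) (msize g)).
rewrite !(@expand_bounded k) ?leq_max ?leqnn ?orbT //.
rewrite scaler_sumr -big_split /=; apply: eq_bigr => m _.
by rewrite mcoeffD mcoeffZ scalerDl scalerA.
Qed.

HB.instance Definition _ B :=
  GRing.isLinear.Build K P P *:%R (expand B) (expand_linear B).

Lemma expandX B m : expand B 'X_[m] = B m.
Proof. by rewrite /expand msuppX big_seq1 mcoeffX eqxx scale1r. Qed.

Lemma mcoeff_expand_shift (s : 'X_{1..n} -> 'X_{1..n}) f b :
  (forall a, s a != b) -> (expand (fun a => 'X_[s a]) f)@_b = 0.
Proof.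
move=> sNb; rewrite /expand linear_sum big1 //= => a _.
by rewrite mcoeffZ mcoeffX (negbTE (sNb a)) mulr0.
Qed.

Variables (B : 'X_{1..n} -> P) (w : 'X_{1..n} -> nat).
Hypothesis unitriangular :
  forall a b, b \in msupp (B a - 'X_[a]) -> (w b < w a)%N.

Lemma mcoeff_unitriangular a b :
  (w a <= w b)%N -> (B a)@_b = (a == b)%:R.
Proof.
move=> le_ab; apply/eqP; rewrite -mcoeffX -subr_eq0 -mcoeffB mcoeff_eq0.
by apply: contraL le_ab => /unitriangular; rewrite ltnNge.
Qed.

(** A nonzero [f] keeps its coefficient at any exponent of maximal weight. *)
Lemma expand_inj : injective (expand B).
Proof.
suff ker0 f : expand B f = 0 -> f = 0.
  by move=> f g eq_fg; apply/eqP; rewrite -subr_eq0; apply/eqP/ker0;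
     rewrite linearB /= eq_fg subrr.
apply: contraPeq => nz_f.
have [a0 a0f] : exists a0, a0 \in msupp f.
  case sf: (msupp f) => [|a0 s]; last by exists a0; rewrite mem_head.
  by rewrite -msupp_eq0 sf in nz_f.
have [a af maxa] : exists2 a, a \in msupp f & {in msupp f, forall b, w b <= w a}%N.
  have le_max : {in msupp f, forall b, w b <= \max_(m <- msupp f) w m}%N.
    by move=> b bf; apply: leq_bigmax_seq.
  have ex : exists k, has (fun a => w a == k) (msupp f).
    by exists (w a0); apply/hasP; exists a0.
  have ub k : has (fun a => w a == k) (msupp f) ->
              (k <= \max_(m <- msupp f) w m)%N.
    by case/hasP=> b bf /eqP <-; apply: le_max.
  case: (ex_maxnP ex ub) => k /hasP[a af /eqP wa] maxk; exists a => // b bf.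
  by rewrite wa; apply: maxk; apply/hasP; exists b.
move=> /(congr1 (mcoeff a)); rewrite mcoeff0 /expand linear_sum /=.
rewrite (bigD1_seq a) ?msupp_uniq //= big_seq_cond big1 ?addr0.
  rewrite mcoeffZ mcoeff_unitriangular // eqxx mulr1 => /eqP.
  by rewrite mcoeff_eq0 af.
move=> b /andP[bf neq_ba]; rewrite mcoeffZ mcoeff_unitriangular ?maxa //.
by rewrite (negbTE neq_ba) mulr0.
Qed.

(** Subtracting [B a] from a monomial leaves terms of smaller weight. *)
Lemma expand_surj f : exists g, f = expand B g.
Proof.
suff surjX a : exists g, 'X_[a] = expand B g.
  elim/mpolyind: f => [|c m f _ _ [g ->]]; first by exists 0; rewrite linear0.
  have [h ->] := surjX m; exists (c *: h + g).
  by rewrite linearD linearZ.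
have [k] := ubnP (w a); elim: k a => // k IH a; rewrite ltnS => le_ak.
have lower h : {in msupp h, forall b, w b < k}%N -> exists g, h = expand B g.
  rewrite [h in exists g, h = _]mpolyE => ltk.
  elim: (msupp h) ltk => [|b s IHs] ltk; first by exists 0; rewrite big_nil linear0.
  have [g eqg] : exists g, \sum_(m <- s) h@_m *: 'X_[m] = expand B g.
    by apply: IHs => x xs; apply: ltk; rewrite inE xs orbT.
  have [g' eqg'] := IH b (ltk b (mem_head b s)).
  by exists (h@_b *: g' + g); rewrite linearD linearZ /= big_cons eqg eqg'.
have [|g eqg] := lower (B a - 'X_[a]).
  by move=> b /unitriangular/leq_trans; apply.
by exists ('X_[a] - g); rewrite linearB /= expandX -eqg opprB addrC subrK.
Qed.

End Expand.

(** * Dominance of exponent vectors *)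

Section Dominance.
Variable n : nat.
Implicit Types (a b : 'X_{1..n}) (s t : {perm 'I_n}) (S T : {set 'I_n}) (i j : 'I_n).
Local Open Scope nat_scope.

(** The second summand breaks ties between equal exponents in favour of the
    smaller index, and it records that index modulo [n]. *)
Definition key a i : nat := n * a i + rev_ord i.

Lemma key_inj a : injective (key a).
Proof.
move=> i j; rewrite /key /= => eq_ij; apply: val_inj => /=.
have := ltn_ord i; have := ltn_ord j.
case: (ltngtP (a i) (a j)) => [||eq_a]; [nia | nia | rewrite eq_a in eq_ij; lia].
Qed.

Lemma ltn_key a i j :
  (key a i < key a j) = (a i < a j) || (a i == a j) && (j < i).
Proof.
rewrite /key /=; have := ltn_ord i; have := ltn_ord j.
by case: (ltngtP (a i) (a j)) => /= [lt_ij|lt_ji|->] ltj lti; nia.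
Qed.

Definition sorts s a := forall i j, i < j -> key a (s j) < key a (s i).

Lemma sorts_exists a : exists s, sorts s a.
Proof.
pose gt_key i j := key a j <= key a i.
have tr : transitive gt_key by move=> i j k; rewrite /gt_key => ? ?; lia.
have tot : total gt_key by move=> i j; apply: leq_total.
have /tuple_permP[s eqs] : perm_eq (sort gt_key (enum 'I_n)) (ord_tuple n).
  by rewrite perm_sort val_ord_tuple.
exists s => i j lt_ij; rewrite ltn_neqAle (inj_eq (@key_inj a)).
rewrite (inj_eq perm_inj) -val_eqE gtn_eqF //=.
have sz : size (sort gt_key (enum 'I_n)) = n by rewrite size_sort size_enum_ord.
have := sorted_ltn_nth tr (s i) (sort_sorted tot (enum 'I_n)).
move=> /(_ i j); rewrite !inE sz !ltn_ord => /(_ isT isT lt_ij).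
rewrite eqs /gt_key.
have tnthE (k : 'I_n) : nth (s i) [tuple tnth (ord_tuple n) (s i0) | i0 < n] k = s k.
  by rewrite -tnth_nth tnth_mktuple tnth_ord_tuple.
by rewrite !tnthE.
Qed.

Definition sort_perm a : {perm 'I_n} := sval (cid (sorts_exists a)).

Lemma sort_permP a : sorts (sort_perm a) a.
Proof. exact: (svalP (cid (sorts_exists a))). Qed.

Definition top_set s k : {set 'I_n} := s @: [set i : 'I_n | i < k].

Lemma mem_top_set s k i : (s i \in top_set s k) = (i < k).
Proof. by rewrite mem_imset ?inE //; apply: perm_inj. Qed.

Lemma card_top_set s k : k <= n -> #|top_set s k| = k.
Proof.
rewrite card_imset => [le_kn|]; last exact: perm_inj.
by rewrite -sum1dep_card (big_ord_narrow le_kn) sum1_card card_ord.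
Qed.

(** The index [s i] is the one whose key is exceeded by exactly [i] others. *)
Lemma sorts_uniq s t a : sorts s a -> sorts t a -> s = t.
Proof.
have rank u i : sorts u a -> [set x | key a (u i) < key a x] = top_set u i.
  move=> us; apply/setP=> x; rewrite inE -(permKV u x) mem_top_set.
  by move: (u^-1%g x) => y; case: (ltngtP y i) => [/us|/us/ltnW|/val_inj ->]; lia.
move=> ss ts; apply/permP=> i; have tK := permKV t (s i).
set k := t^-1%g (s i) in tK; suff eqk : i = k by rewrite [in RHS]eqk tK.
have cardE u (j : 'I_n) : #|top_set u j| = j by rewrite card_top_set ?(ltnW (ltn_ord j)).
by apply: val_inj; rewrite -[LHS](cardE s) -[RHS](cardE t) -!rank // tK.
Qed.

Lemma top_setI s (j k : nat) : top_set s j :&: top_set s k = top_set s (minn j k).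
Proof.
by apply/setP=> x; rewrite -(permKV s x) inE !mem_top_set leq_min.
Qed.

(** The indices in [S] but not among the [#|S|] top ones can be exchanged for as
    many top indices outside [S], which all have larger keys. *)
Lemma leq_sum_top_set s a S : sorts s a ->
  \sum_(i in S) key a i <= \sum_(i in top_set s #|S|) key a i.
Proof.
move=> ss; set T := top_set s #|S|.
have cardT : #|T| = #|S| by rewrite card_top_set // -[X in _ <= X]card_ord max_card.
rewrite (big_setID T) [X in _ <= X](big_setID S) /= setIC leq_add2l.
pose M := \max_(i in S :\: T) key a i.
have cardD : #|S :\: T| = #|T :\: S|.
  by rewrite !cardsD cardT setIC.
apply: (@leq_trans (\sum_(i in S :\: T) M)).
  by apply: leq_sum => i iST; apply: leq_bigmax_cond.
rewrite sum_nat_const cardD -sum_nat_const; apply: leq_sum => i.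
rewrite inE -(permKV s i) mem_top_set => /andP[_ lt_i].
apply/bigmax_leqP => j; rewrite inE -(permKV s j) mem_top_set -leqNgt => /andP[le_j _].
by apply/ltnW/ss/(leq_trans lt_i).
Qed.

(** This version of the dominance order, where [s] is meant to sort [a], needs
    no sorting of [b]: it bounds the sums over all sets of [k] keys of [b], not
    only over the [k] largest ones. *)
Definition dominated s a b :=
  forall S, \sum_(i in S) key b i <= \sum_(i in top_set s #|S|) key a i.

(** The exponent of the product of the [x_i ^ c] over [i] in [S], that is of one
    term of an elementary symmetric polynomial in the [x_i ^ c]. *)
Definition layer c S : 'X_{1..n} := [multinom c * (i \in S) | i < n].

Lemma sum_key_layer a c S T :
  \sum_(i in T) key (a + layer c S)%MM i
  = \sum_(i in T) key a i + n * (c * #|T :&: S|).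
Proof.
have keyD i : key (a + layer c S)%MM i = key a i + n * (c * (i \in S)).
  by rewrite /key mnmDE mnmE mulnDr addnAC.
rewrite (eq_bigr _ (fun i _ => keyD i)) big_split /= -!big_distrr /=.
congr (_ + n * (c * _)); rewrite -big_mkcondr -sum1_card.
by apply: eq_bigl => i; rewrite inE.
Qed.

Lemma sum_key_layer_top_set s a c (j k : nat) : j <= n -> k <= n ->
  \sum_(i in top_set s k) key (a + layer c (top_set s j))%MM i
  = \sum_(i in top_set s k) key a i + n * (c * minn k j).
Proof.
by move=> le_jn le_kn; rewrite sum_key_layer top_setI card_top_set // geq_min le_kn.
Qed.

(** A set of [k] indices meets [S] in at most [minn k #|S|] points, a bound that
    nested initial segments of [s] attain. *)
Lemma dominated_layer s a b c S : dominated s a b ->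
  dominated s (a + layer c (top_set s #|S|))%MM (b + layer c S)%MM.
Proof.
move=> dom_ab T; have leTn (U : {set 'I_n}) : #|U| <= n.
  by rewrite -[X in _ <= X]card_ord max_card.
rewrite sum_key_layer sum_key_layer_top_set // leq_add // !leq_mul //.
by rewrite leq_min !subset_leq_card ?subsetIl ?subsetIr.
Qed.

(** No other pair contributes to the leading exponent of a product with an
    elementary symmetric polynomial, so the leading coefficient stays [1]. On the
    [#|S|] largest keys of [a], both [b] and [S] have to reach their bounds. *)
Lemma dominated_layer_eq s a b c S : 0 < c -> dominated s a b ->
  (b + layer c S = a + layer c (top_set s #|S|))%MM -> b = a /\ S = top_set s #|S|.
Proof.
move=> c_gt0 dom_ab eq_ab.
have le_Sn : #|S| <= n by rewrite -[X in _ <= X]card_ord max_card.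
have eqS : S = top_set s #|S|.
  have [n0|n_gt0] := posnP n; first by apply/setP=> x; have := ltn_ord x; lia.
  have := sum_key_layer b c S (top_set s #|S|).
  rewrite eq_ab sum_key_layer_top_set // minnn.
  have := dom_ab (top_set s #|S|); rewrite card_top_set // => le_ab eq_sum.
  have : #|S| <= #|top_set s #|S| :&: S|.
    by rewrite -(leq_pmul2l c_gt0) -(leq_pmul2l n_gt0); lia.
  move=> le_card; have /eqP eqI : top_set s #|S| :&: S == S.
    by rewrite eqEcard subsetIr.
  apply/eqP; rewrite eqEcard card_top_set // leqnn andbT.
  by apply/setIidPl; rewrite setIC.
split=> //; move: eq_ab; rewrite -eqS.
exact: addIm.
Qed.

Definition weight a : nat :=
  \sum_(k < n.+1) \sum_(i in top_set (sort_perm a) k) key a i.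

(** Equality would force the two decreasing sequences of keys to agree; a key
    determines the index that it comes from modulo [n]. *)
Lemma dominated_weight s a b : sorts s a -> dominated s a b -> b != a ->
  weight b < weight a.
Proof.
move=> ss dom_ab neq_ab; rewrite (sorts_uniq ss (sort_permP a)) in dom_ab.
set sa := sort_perm a in dom_ab *; set sb := sort_perm b.
have le_k (k : 'I_n.+1) :
    \sum_(i in top_set sb k) key b i <= \sum_(i in top_set sa k) key a i.
  by have := dom_ab (top_set sb k); rewrite card_top_set // -ltnS.
have le_w : weight b <= weight a by apply: leq_sum => k _; apply: le_k.
rewrite ltn_neqAle le_w andbT; apply: contra neq_ab => /eqP eq_w.
have eq_k k : k <= n ->
    \sum_(i in top_set sb k) key b i = \sum_(i in top_set sa k) key a i.
  rewrite -ltnS => lt_kn; apply/eqP; rewrite eqn_leq (le_k (Ordinal lt_kn)) /=.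
  move: eq_w; rewrite /weight (bigD1 (Ordinal lt_kn)) //=.
  rewrite [in RHS](bigD1 (Ordinal lt_kn)) //= -/sa -/sb => eq_w.
  rewrite -(leq_add2r (\sum_(i < n.+1 | i != Ordinal lt_kn)
    \sum_(j in top_set sb i) key b j)) eq_w leq_add2l.
  by apply: leq_sum => i _; apply: le_k.
have top_setS t (i : 'I_n) : top_set t i.+1 = t i |: top_set t i.
  by apply/setP=> x; rewrite -(permKV t x) !inE !mem_top_set (inj_eq perm_inj) ltnS leq_eqVlt.
have eq_key i : key b (sb i) = key a (sa i).
  have := eq_k i.+1 (ltn_ord i).
  rewrite !top_setS !big_setU1 ?mem_top_set ?ltnn //= (eq_k i) ?(ltnW (ltn_ord i)) //.
  by move/addIn.
have eq_rev x y : key b x = key a y -> x = y /\ b x = a y.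
  rewrite /key /= => eq_xy; have ltx := ltn_ord x; have lty := ltn_ord y.
  have eqb : b x = a y by nia.
  by split=> //; apply: val_inj => /=; rewrite eqb in eq_xy; lia.
apply/eqP/mnmP=> x; rewrite -(permKV sb x); have [e ->] := eq_rev _ _ (eq_key (sb^-1%g x)).
by rewrite -e.
Qed.

End Dominance.

(** * Leading exponents *)

Section TailSums.
Variable n : nat.
Local Open Scope nat_scope.

(** The upper bound [n] on [i] is not built in, so that [tailsum F n = 0] ends the
    recursion of [tailsum_step]. *)
Definition tailsum (F : 'I_n -> nat) (i : nat) : nat := \sum_(j < n | i <= j) F j.

Lemma tailsum_step F (i : 'I_n) : tailsum F i = F i + tailsum F i.+1.
Proof.
rewrite /tailsum (bigD1 i) //=; congr (_ + _); apply: eq_bigl => j.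
by rewrite -val_eqE ltn_neqAle andbC eq_sym.
Qed.

Lemma tailsum_ge F i : n <= i -> tailsum F i = 0.
Proof. by move=> le_ni; rewrite /tailsum big1 // => j; have := ltn_ord j; lia. Qed.

Lemma tailsum_eq F (H : nat -> nat) :
  H n = 0 -> (forall i : 'I_n, H i = F i + H i.+1) ->
  forall i, i <= n -> tailsum F i = H i.
Proof.
move=> Hn HS i le_in; rewrite -(subKn le_in).
elim: (n - i) => [|k IH]; first by rewrite subn0 tailsum_ge.
have [le_nk|lt_kn] := leqP n k.
  by rewrite (_ : n - k.+1 = n - k) //; lia.
have lt_n : n - k.+1 < n by lia.
have := tailsum_step F (Ordinal lt_n); rewrite /= => ->.
have := HS (Ordinal lt_n); rewrite /= => ->.
by rewrite (_ : (n - k.+1).+1 = n - k) ?IH //; lia.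
Qed.

Lemma tailsum_inj F G : (forall i : 'I_n, tailsum F i = tailsum G i) -> F =1 G.
Proof.
move=> eqFG i; have := eqFG i; rewrite !tailsum_step.
suff -> : tailsum F i.+1 = tailsum G i.+1 by move/addIn.
have [lt_in|le_ni] := ltnP i.+1 n; first exact: eqFG (Ordinal lt_in).
by rewrite !tailsum_ge.
Qed.

Lemma tailsum_add F G i :
  tailsum (fun j => F j + G j) i = tailsum F i + tailsum G i.
Proof. exact: big_split. Qed.

Lemma tailsum_mul c F i : tailsum (fun j => c * F j) i = c * tailsum F i.
Proof. by rewrite /tailsum big_distrr. Qed.

Lemma tailsum_delta c (j : 'I_n) i :
  tailsum (fun k => c * (j == k)) i = c * (i <= j).
Proof.
rewrite tailsum_mul /tailsum; congr (c * _).
case: (leqP i j) => [le_ij|lt_ji].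
  by rewrite (bigD1 j) //= eqxx big1 // => k /andP[_ /negbTE]; rewrite eq_sym => ->.
by rewrite big1 // => k le_ik; case: eqP => // eq_jk; move: le_ik; rewrite -eq_jk leqNgt lt_ji.
Qed.

Lemma decreasing_ord (f : 'I_n -> nat) :
  (forall i k : 'I_n, k = i.+1 :> nat -> f k < f i) ->
  forall i j : 'I_n, i < j -> f j < f i.
Proof.
move=> decr i [j /=]; elim: j => // j IH lt_jn; rewrite ltnS.
rewrite leq_eqVlt => /predU1P[eq_ij|lt_ij]; first by apply: decr; rewrite /= eq_ij.
by apply: ltn_trans (IH (ltnW lt_jn) lt_ij); apply: decr.
Qed.

End TailSums.

Lemma eq_digits (m c c' x y : nat) : (c < m)%N -> (c' < m)%N ->
  (m * x + c = m * y + c')%N -> c = c' /\ x = y.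
Proof.
move=> lt_c lt_c' eq_xy; have eqx : x = y by case: (ltngtP x y); nia.
by split=> //; rewrite eqx in eq_xy; lia.
Qed.

Section LeadingExponent.
Variables r p n : nat.
Local Notation d := (r %/ p)%N.
Implicit Types (g : colored_perm r n) (v : 'X_{1..n}) (i j k : 'I_n).
Local Open Scope nat_scope.

(** The exponent of the variables in the terms of [theta j]. *)
Definition theta_exp j : nat := if j.+1 < n then r else d.

(** The leading exponent of [x_g] times the product of the [theta j ^+ v j]: its
    entry at the index in position [i] collects the contributions of the
    [theta j] with [i <= j]. *)
Definition lead g v : 'X_{1..n} :=
  [multinom fexp g ((perm_of g)^-1%g i)
     + tailsum (fun j => theta_exp j * v j) ((perm_of g)^-1%g i) | i < n].

Lemma leadE g v i :
  lead g v (perm_of g i) = fexp g i + tailsum (fun j => theta_exp j * v j) i.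
Proof. by rewrite mnmE permK. Qed.

(** A new factor [theta j] raises the exponents at the first [j + 1] positions of
    the word, which still sorts the result. *)
Lemma lead_step g v j :
  lead g (v + U_(j))%MM = (lead g v + layer (theta_exp j) (top_set (perm_of g) j.+1))%MM.
Proof.
apply/mnmP=> x; rewrite -(permKV (perm_of g) x); move: ((perm_of g)^-1%g x) => i.
rewrite leadE mnmDE leadE mnmE mem_top_set ltnS -addnA; congr (_ + _).
rewrite -tailsum_delta -tailsum_add; apply: eq_bigr => k _.
rewrite mnmDE mnm1E mulnDr; congr (_ + _).
by case: eqP => [->|]; rewrite ?muln0.
Qed.

Lemma descnum_tailsum g i : descnum g i = tailsum (fun j => j \in Des g : nat) i.
Proof.
rewrite /descnum /tailsum -sum1dep_card big_mkcond [RHS]big_mkcond /=.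
by apply: eq_bigr => j _; case: (j \in _); case: (i <= j).
Qed.

Lemma mem_Des g i k : k = i.+1 :> nat -> (i \in Des g) = prec (letter g k) (letter g i).
Proof.
move=> eq_ki; rewrite inE; apply/existsP/idP => [[k' /andP[/eqP eq_k'i]]|lt_ki].
  by rewrite (_ : k' = k) //; apply: val_inj; rewrite /= eq_k'i eq_ki.
by exists k; rewrite eq_ki eqxx.
Qed.

Lemma last_notin_Des g i : i.+1 = n -> i \notin Des g.
Proof.
move=> eq_in; rewrite inE; apply/existsP=> -[k /andP[/eqP eq_ki _]].
by have := ltn_ord k; rewrite eq_ki eq_in ltnn.
Qed.

Lemma fexp_tailsum g i :
  fexp g i = r * tailsum (fun j => j \in Des g : nat) i + color g i.
Proof. by rewrite /fexp descnum_tailsum. Qed.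

(** At a descent [d_i] drops by one, which outweighs any change of color; at an
    ascent the colors decrease weakly and ties are broken by position. *)
Lemma sorts_lead g v : sorts (perm_of g) (lead g v).
Proof.
move=> i j; apply: (decreasing_ord (f := fun i => key (lead g v) (perm_of g i))).
move=> {j}{}i k eq_ki; rewrite ltn_key !leadE !fexp_tailsum.
rewrite (tailsum_step _ i) -eq_ki (tailsum_step (fun j => theta_exp j * v j) i) -eq_ki.
rewrite (mem_Des _ eq_ki) /prec /letter /=.
have neq_s : perm_of g i != perm_of g k :> nat.
  by rewrite val_eqE (inj_eq perm_inj) -val_eqE /= eq_ki neq_ltn ltnSn.
have := ltn_ord (color g k); have := ltn_ord (color g i).
move: (tailsum _ k) (tailsum _ k) (theta_exp i * v i) => D T V.
rewrite -(inj_eq val_inj) /=.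
case: (ltngtP (color g i) (color g k)) => /= [lt_c|lt_c|eq_c] ltr1 ltr2.
- by apply/orP; left; nia.
- by apply/orP; left; nia.
- rewrite eq_c; case: (ltngtP (perm_of g i) (perm_of g k)) neq_s => //= lt_s _.
    by case: (posnP V) => [->|V0]; [rewrite ltnn; nia | nia].
  by apply/orP; left; nia.
Qed.

Hypotheses (r_gt0 : 0 < r) (p_gt0 : 0 < p) (n_gt0 : 0 < n) (dvd_pr : p %| r).

Lemma d_gt0 : 0 < d.
Proof. by rewrite divn_gt0 // dvdn_leq. Qed.

Lemma theta_exp_gt0 j : 0 < theta_exp j.
Proof. by rewrite /theta_exp; case: ifP; rewrite ?d_gt0. Qed.

Let imax : 'I_n := Ordinal (eq_leq (prednK n_gt0) : n.-1 < n).

Let le_imax i : i <= imax.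
Proof. by rewrite /= -ltnS prednK. Qed.

Let imaxE i : (i.+1 < n) = (i != imax).
Proof. by rewrite -val_eqE /=; have := ltn_ord i; lia. Qed.

(** Only the last invariant contributes to the exponents modulo [r]. *)
Lemma tailsum_theta v i :
  tailsum (fun j => theta_exp j * v j) i
  = r * tailsum (fun j => (j.+1 < n) * v j) i + d * v imax.
Proof.
have <- : tailsum (fun j => (d * v imax) * (imax == j)) i = d * v imax.
  by rewrite tailsum_delta le_imax muln1.
rewrite -tailsum_mul -tailsum_add; apply: eq_bigr => j _.
rewrite /theta_exp imaxE eq_sym; case: (altP eqP) => [<-|_] /=.
  by rewrite muln0 muln1.
by rewrite mul1n muln0 addn0.
Qed.

Lemma fexp_last g : fexp g imax = color g imax.
Proof.
rewrite fexp_tailsum tailsum_step (negbTE (last_notin_Des _ _)) ?prednK //.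
by rewrite tailsum_ge ?prednK // muln0.
Qed.

Lemma GammaE g : (g \in Gamma r p n) = (color g imax < d).
Proof.
rewrite inE; apply/forallP/idP => [/(_ imax)|lt_gd i]; first by rewrite /= prednK // eqxx.
apply/implyP=> /eqP eq_in; rewrite (_ : i = imax) //.
by apply: val_inj => /=; lia.
Qed.

(** The permutation is recovered by sorting, the last color and [v] at the last
    index by division by [d], the other colors modulo [r], and the rest of [v]
    from the differences of consecutive exponents. *)
Lemma lead_inj g g' v v' : g \in Gamma r p n -> g' \in Gamma r p n ->
  lead g v = lead g' v' -> g = g' /\ v = v'.
Proof.
rewrite !GammaE => gG g'G eq_l.
have eq_s : perm_of g = perm_of g'.
  by apply: (@sorts_uniq _ _ _ (lead g v)); [|rewrite eq_l]; apply: sorts_lead.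
have eq_i i : fexp g i + tailsum (fun j => theta_exp j * v j) i
            = fexp g' i + tailsum (fun j => theta_exp j * v' j) i.
  by rewrite -!leadE -eq_s eq_l.
have U0 u : tailsum (fun j => (j.+1 < n) * u j) imax = 0.
  by rewrite tailsum_step imaxE eqxx tailsum_ge ?prednK.
have [_ eq_last] : color g imax = color g' imax :> nat /\ v imax = v' imax.
  apply: (eq_digits gG g'G); have := eq_i imax.
  by rewrite !fexp_last !tailsum_theta !U0 muln0 !add0n; lia.
have eq_c i : color g i = color g' i.
  apply: val_inj; have := eq_i i.
  rewrite !fexp_tailsum !tailsum_theta eq_last.
  set D := tailsum _ _; set U := tailsum _ _.
  set D' := tailsum _ _; set U' := tailsum _ _ => eq_DU.
  suff /(eq_digits (ltn_ord _) (ltn_ord _))[] : r * (D + U) + color g i = r * (D' + U') + color g' i by [].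
  by rewrite !mulnDr; lia.
have eq_g : g = g'.
  case: g g' eq_s eq_c {gG g'G eq_l eq_i} => [c s] [c' s'] /= -> eq_c.
  by congr (_, _); apply/ffunP.
split=> //; rewrite -eq_g in eq_i.
have eqT := tailsum_inj (fun i => addnI (eq_i i)).
by apply/mnmP=> i; apply/eqP; rewrite -(eqn_pmul2l (theta_exp_gt0 i)); apply/eqP/eqT.
Qed.

(** Sort [a], and take out the largest power [m] of [theta_n]. The colors of [g]
    are the remainders modulo [r] of the remaining exponents [b i]; their
    quotients [q i] drop at least by one at each descent, and [v] records the
    excess of these drops. *)
Lemma lead_surj a : exists2 gv : colored_perm r n * 'X_{1..n},
  gv.1 \in Gamma r p n & lead gv.1 gv.2 = a.
Proof.
pose s := sort_perm a; pose m := a (s imax) %/ d; pose b i := a (s i) - d * m.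
have le_a i j : i <= j -> a (s j) <= a (s i).
  rewrite leq_eqVlt => /predU1P[/val_inj -> //|/(sort_permP a)].
  by rewrite ltn_key -/s => /orP[/ltnW|/andP[/eqP ->]].
have le_dm : d * m <= a (s imax) by rewrite mulnC leq_trunc_div.
have aE i : a (s i) = b i + d * m.
  by rewrite subnK //; apply: leq_trans (le_a _ _ (le_imax i)).
have b_last : b imax < d.
  by rewrite /b /m [X in X - _](divn_eq _ d) mulnC addKn ltn_mod d_gt0.
have le_dr : d <= r by apply: leq_div.
(* [qn] extends [q] by [0] beyond the last index. *)
pose q i := b i %/ r; pose qn (k : nat) := oapp q 0 (insub k : option 'I_n).
have qnE i : qn i = q i by rewrite /qn valK.
have qn_ge (k : nat) : n <= k -> qn k = 0 by move=> le_nk; rewrite /qn insubN -?leqNgt.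
have q_last : q imax = 0 by rewrite /q divn_small // (leq_trans b_last).
pose g : colored_perm r n := ([ffun i => Ordinal (ltn_pmod (b i) r_gt0)], s).
have gE i : color g i = b i %% r :> nat by rewrite /color ffunE.
have drop j : (j \in Des g) <= q j - qn j.+1.
  have [lt_jn|le_nj] := ltnP j.+1 n; last by rewrite (negbTE (last_notin_Des _ _)) //; have := ltn_ord j; lia.
  pose k := Ordinal lt_jn; rewrite -[j.+1]/(val k) qnE.
  case: (boolP (j \in Des g)) => //=; rewrite (@mem_Des g j k) // subn_gt0.
  have lt_jk : j < k by rewrite /=.
  have := sort_permP a lt_jk; rewrite ltn_key -/s => lt_key.
  rewrite /prec /letter /= -(inj_eq val_inj) /= !gE -/s => prec_kj.
  have := aE j; have := aE k; have := divn_eq (b j) r; have := divn_eq (b k) r.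
  rewrite -/(q j) -/(q k) => eqbk eqbj eqak eqaj.
  rewrite ltnNge; apply/negP=> le_q.
  have le_qr : q j * r <= q k * r by rewrite leq_mul2r le_q orbT.
  case/orP: prec_kj => [lt_c|/andP[/eqP eq_c lt_s]].
    by case/orP: lt_key => [|/andP[]]; lia.
  by case/orP: lt_key => [|/andP[_]]; [lia | rewrite ltnNge ltnW].
pose v := [multinom if j == imax then m else q j - qn j.+1 - (j \in Des g) | j < n].
exists (g, v) => /=; first by rewrite GammaE gE; apply: leq_ltn_trans (leq_mod _ _) b_last.
apply/mnmP=> x; rewrite -(permKV s x); move: (s^-1%g x) => i.
have /= -> := leadE g v i.
have le_q j : qn j.+1 <= q j.
  have [lt_jn|le_nj] := ltnP j.+1 n; last by rewrite qn_ge.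
  rewrite -[j.+1]/(val (Ordinal lt_jn)) qnE leq_div2r // leq_sub2r //.
  exact/le_a/leqnSn.
have vmax : v imax = m by rewrite mnmE eqxx.
have sumq : tailsum (fun j => j \in Des g : nat) i
            + tailsum (fun j => (j.+1 < n) * v j) i = qn i.
  rewrite -tailsum_add; apply: tailsum_eq; [exact: qn_ge | | exact/ltnW].
  move=> j; rewrite qnE mnmE imaxE; case: (altP eqP) => [->|_] /=.
    by rewrite prednK // (negbTE (last_notin_Des _ _)) ?prednK // qn_ge // q_last.
  by have := le_q j; have := drop j; lia.
rewrite fexp_tailsum gE tailsum_theta vmax aE [b i in RHS](divn_eq _ r) -/(q i) -qnE -sumq.
lia.
Qed.

End LeadingExponent.

(** * The descent monomials *)

Lemma mnm_ind_step n (Q : 'X_{1..n} -> Prop) :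
  Q 0%MM -> (forall v j, Q v -> Q (v + U_(j))%MM) -> forall v, Q v.
Proof.
move=> Q0 QS v; have [k] := ubnP (mdeg v); elim: k v => // k IH v lt_vk.
have [/eqP|nz_v] := eqVneq (mdeg v) 0%N; first by rewrite mdeg_eq0 => /eqP ->.
have [j vj] : exists j, v j != 0%N.
  apply/existsP; apply: contraR nz_v; rewrite negb_exists => /forallP v0.
  by rewrite mdeg_eq0; apply/eqP/mnmP=> i; rewrite mnm0E; apply/eqP; rewrite -[_ == _]negbK.
have /submK eq_v : (U_(j) <= v)%MM by rewrite lep1mP.
by rewrite -eq_v; apply/QS/IH; move: lt_vk; rewrite -{1}eq_v mdegD mdeg1; lia.
Qed.

Section Basis.
Variables (K : fieldType) (r p n : nat).
Hypotheses (r_gt0 : (0 < r)%N) (p_gt0 : (0 < p)%N) (n_gt0 : (0 < n)%N).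
Hypothesis dvd_pr : (p %| r)%N.
Local Notation P := {mpoly K[n]}.
Local Notation colored := (colored_perm r n).
Local Notation theta := (theta K r p).
Local Notation lead := (lead p).
Local Notation ideal := (@ideal_H K r p n).
Implicit Types (g : colored) (v a b : 'X_{1..n}) (j : 'I_n) (f h : P).

(** The last invariant fits the same pattern: it is the elementary symmetric
    polynomial of degree [n] in the powers [x_i ^ d]. *)
Lemma theta_layers j :
  theta j = \sum_(S : {set 'I_n} | #|S| == j.+1) 'X_[layer (theta_exp r p j) S].
Proof.
have layerE c S : 'X_[layer c S] = \prod_(i in S) 'X_i ^+ c :> P.
  rewrite mprodXnE; congr 'X_[_]; apply/mnmP=> i; rewrite mnmE mnm_sumE.
  rewrite big_mkcond (bigD1 i) //= big1 => [|k /negbTE neq_ki].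
    by rewrite mulmnE mnm1E eqxx; case: (i \in S); rewrite ?muln1 ?muln0 ?mul1n ?addn0.
  by rewrite mulmnE mnm1E neq_ki; case: (k \in S).
rewrite /Defs.theta /theta_exp; case: ltnP => [lt_jn|le_nj].
  rewrite /mesym raddf_sum /=; apply: eq_bigr => S _.
  rewrite layerE rmorph_prod; apply: eq_bigr => i _ /=.
  by rewrite comp_mpolyXU -tnth_nth tnth_mktuple.
have eq_jn : j.+1 = n by apply/eqP; rewrite eqn_leq le_nj ltn_ord.
rewrite (big_pred1 setT) => [|S].
  by rewrite layerE; apply: eq_bigl => i; rewrite inE.
rewrite eq_jn /=; apply/eqP/eqP => [cardS|->]; last by rewrite cardsT card_ord.
by apply/eqP; rewrite eqEcard subsetT cardsT card_ord cardS leqnn.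
Qed.

Definition descent_prod g v : P := xmon K g * \prod_(j < n) theta j ^+ v j.

Lemma descent_prod0 g : descent_prod g 0%MM = xmon K g.
Proof. by rewrite /descent_prod big1 ?mulr1 // => j _; rewrite mnm0E. Qed.

Lemma descent_prod_step g v j :
  descent_prod g (v + U_(j))%MM = theta j * descent_prod g v.
Proof.
rewrite /descent_prod mulrCA; congr (_ * _).
rewrite (bigD1 j) //= [in RHS](bigD1 j) //= mulrA -exprS mnmDE mnm1E eqxx addn1.
congr (_ * _); apply: eq_bigr => k neq_kj.
by rewrite mnmDE mnm1E eq_sym (negbTE neq_kj) addn0.
Qed.

Lemma xmonE g : xmon K g = 'X_[lead g 0%MM].
Proof.
rewrite /xmon mprodXnE; congr 'X_[_]; apply/mnmP=> x.
rewrite -(permKV (perm_of g) x); move: ((perm_of g)^-1%g x) => i.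
have t0 : tailsum (fun j => theta_exp r p j * 0%MM j)%N i = 0%N.
  by apply: big1 => k _; rewrite mnm0E muln0.
rewrite leadE t0 addn0 mnm_sumE (bigD1 i) //= mulmnE mnm1E eqxx mul1n big1 ?addn0 //.
by move=> k neq_ki; rewrite mulmnE mnm1E (inj_eq perm_inj) (negbTE neq_ki).
Qed.

(** By induction on [v]: a term of [theta j * B] is a product of a term [b'] of
    [B] with a layer [S], and only the leading term of [B] times the layer of the
    first [j + 1] positions reaches the new leading exponent. *)
Lemma descent_prod_lead g v b : b \in msupp (descent_prod g v - 'X_[lead g v]) ->
  dominated (perm_of g) (lead g v) b /\ b != lead g v.
Proof.
elim/mnm_ind_step: v b => [|v j IH] b.
  by rewrite descent_prod0 xmonE subrr msupp0.
set s := perm_of g in IH *; rewrite descent_prod_step lead_step -/s.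
set a := lead g v; set c := theta_exp r p j; set B := descent_prod g v in IH *.
have c_gt0 : (0 < c)%N by apply: theta_exp_gt0.
have card_top : #|top_set s j.+1| = j.+1 by rewrite card_top_set.
have below b' (S : {set 'I_n}) : dominated s a b' -> #|S| = j.+1 ->
    ~~ ((b' == a) && (S == top_set s j.+1)) -> b = (b' + layer c S)%MM ->
    dominated s (a + layer c (top_set s j.+1)) b /\
    b != (a + layer c (top_set s j.+1))%MM.
  move=> dom_b' cardS neq ->; rewrite -cardS; split; first exact: dominated_layer.
  apply: contra neq => /eqP /(dominated_layer_eq c_gt0 dom_b')[-> ->].
  by rewrite cardS !eqxx.
have theta_a : theta j * 'X_[a] = 'X_[a + layer c (top_set s j.+1)]
    + \sum_(S : {set 'I_n} | (#|S| == j.+1) && (S != top_set s j.+1))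
        'X_[a + layer c S].
  rewrite theta_layers mulr_suml (bigD1 (top_set s j.+1)) ?card_top //=.
  by rewrite addmC mpolyXD; congr (_ + _); apply: eq_bigr => S _; rewrite addmC mpolyXD.
have -> : theta j * B - 'X_[a + layer c (top_set s j.+1)]
        = theta j * (B - 'X_[a])
          + \sum_(S : {set 'I_n} | (#|S| == j.+1) && (S != top_set s j.+1))
              'X_[a + layer c S].
  by rewrite mulrBr theta_a opprD addrA subrK.
move/msuppD_le; rewrite mem_cat => /orP[/msuppM_le|/msupp_sum_le].
  case/allpairsP=> -[m b'] /= [m_th /IH[dom_b' neq_b'] eq_b].
  move: m_th; rewrite theta_layers => /msupp_sum_le/flattenP[_ /mapP[S S_in ->]].
  move: S_in; rewrite mem_filter => /andP[/eqP cardS _].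
  rewrite msuppX inE => /eqP eq_m.
  apply: (below b' S) => //; last by rewrite eq_b eq_m addmC.
  by rewrite (negbTE neq_b').
case/flattenP=> _ /mapP[S S_in ->]; rewrite msuppX inE => /eqP eq_b.
move: S_in; rewrite mem_filter => /andP[/andP[/eqP cardS neqS] _].
apply: (below a S) => //.
  by move=> T; apply/leq_sum_top_set/sorts_lead.
by rewrite negb_and neqS orbT.
Qed.

Definition index a : colored * 'X_{1..n} :=
  sval (cid2 (lead_surj r_gt0 p_gt0 n_gt0 dvd_pr a)).

Lemma index_Gamma a : (index a).1 \in Gamma r p n.
Proof. by rewrite /index; case: cid2. Qed.

Lemma lead_index a : lead (index a).1 (index a).2 = a.
Proof. by rewrite /index; case: cid2. Qed.

Lemma index_lead g v : g \in Gamma r p n -> index (lead g v) = (g, v).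
Proof.
move=> gG; have := lead_index (lead g v).
move/(lead_inj r_gt0 p_gt0 n_gt0 dvd_pr (index_Gamma _) gG).
by case: (index _) => [? ?] /= [-> ->].
Qed.

(** The products [descent_prod g v], indexed by their leading exponents. *)
Definition descent_basis a : P := descent_prod (index a).1 (index a).2.

Lemma descent_basis_lead g v : g \in Gamma r p n ->
  descent_basis (lead g v) = descent_prod g v.
Proof. by move=> gG; rewrite /descent_basis index_lead. Qed.

Lemma descent_basis_unitriangular a b :
  b \in msupp (descent_basis a - 'X_[a]) -> (weight b < weight a)%N.
Proof.
rewrite -{2}[a]lead_index => /descent_prod_lead[]; rewrite lead_index.
by apply: dominated_weight; rewrite -{2}[a]lead_index; apply: sorts_lead.
Qed.

Local Notation descent_map := (expand descent_basis).

Definition theta_shift j a := lead (index a).1 ((index a).2 + U_(j))%MM.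

(** In the basis [descent_basis], multiplication by [theta j] sends each basis
    vector to a basis vector. *)
Lemma theta_expand j f :
  theta j * descent_map f = descent_map (expand (fun a => 'X_[theta_shift j a]) f).
Proof.
rewrite [in LHS]/expand [expand _ f in RHS]/expand linear_sum mulr_sumr.
apply: eq_bigr => a _; rewrite linearZ /= expandX -scalerAr; congr (_ *: _).
by rewrite -descent_prod_step -descent_basis_lead // index_Gamma.
Qed.

Lemma theta_ideal j f : theta j * f \in ideal.
Proof.
apply/ideal_HP; exists (fun k => if k == j then f else 0).
rewrite (bigD1 j) //= eqxx big1 ?addr0 => [|k /negbTE ->]; last by rewrite mul0r.
by rewrite mulrC.
Qed.

Lemma descent_prod_ideal g v : v != 0%MM -> descent_prod g v \in ideal.
Proof.
elim/mnm_ind_step: v => [|v j _]; first by rewrite eqxx.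
by rewrite descent_prod_step theta_ideal.
Qed.

Local Notation V := (coinvariant K r p n).
Local Notation coset := (@coset_H K r p n).

Lemma coset_sum (I : finType) (A : {set I}) (c : I -> K) (F : I -> P) :
  \sum_(i in A) c i *: (coset (F i) : V) = coset (\sum_(i in A) c i *: F i).
Proof.
rewrite (big_morph coset (id1 := 0) (op1 := +%R)).
- by apply: eq_bigr => i _; apply: coscaleE.
- exact: coset_HD.
- exact: raddf0.
Qed.

Lemma coset_ideal f : f \in ideal -> coset f = coset 0.
Proof. by move=> f_in; apply/coset_H_eq; rewrite subr0. Qed.

Lemma descent_spans : spans (V := V) (Gamma r p n) (fun g => coset (xmon K g)).
Proof.
move=> u; have [f ->] : exists f, u = coset f := ex_intro _ _ (esym (coset_HK u)).
have [h ->] := expand_surj descent_basis_unitriangular f.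
suff [c eq_c] : exists c : colored -> K,
    coset (descent_map h) = coset (\sum_(g in Gamma r p n) c g *: xmon K g).
  by exists c; rewrite coset_sum.
elim/mpolyind: h => [|c m h _ _ [e IH]].
  by exists (fun=> 0); rewrite linear0 big1 // => g _; rewrite scale0r.
pose delta g := c * ((lead g 0 == m)%MM)%:R.
exists (fun g => delta g + e g); rewrite linearD linearZ /= expandX.
under eq_bigr do rewrite scalerDl.
rewrite big_split /= !coset_HD IH; congr (_ + _).
have [v0|nz_v] := eqVneq (index m).2 0%MM.
  have eq_m : lead (index m).1 0%MM = m by rewrite -v0 lead_index.
  rewrite (bigD1 (index m).1) ?index_Gamma //= big1 ?addr0 /delta.
    by rewrite eq_m eqxx mulr1 /descent_basis v0 descent_prod0.
  move=> g /andP[gG neq_g]; case: eqP => [eq_gm|]; last by rewrite mulr0 scale0r.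
  by rewrite -eq_gm index_lead // eqxx in neq_g.
rewrite big1 => [|g gG].
  by apply: coset_ideal; rewrite -mul_mpolyC; apply/ideal_HM/descent_prod_ideal.
rewrite /delta; case: eqP => [eq_gm|]; last by rewrite mulr0 scale0r.
by rewrite -eq_gm index_lead // eqxx in nz_v.
Qed.

(** An element [\sum_j h_j theta_j] of the ideal is the image under [descent_map]
    of a polynomial all of whose exponents are [lead g v] with [v] nonzero; the
    combinations of the [x_g] come from the exponents [lead g 0]. *)
Lemma descent_lin_indep :
  lin_indep (V := V) (Gamma r p n) (fun g => coset (xmon K g)).
Proof.
move=> c; rewrite coset_sum -[0 : V](raddf0 (@coset_H K r p n)).
move/coset_H_eq; rewrite subr0 => /ideal_HP[h eq_h] g gG.
have surj j := cid (expand_surj descent_basis_unitriangular (h j)).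
pose k j := sval (surj j).
have hE j : h j = descent_map (k j) by apply: (svalP (surj j)).
have : descent_map (\sum_(g in Gamma r p n) c g *: 'X_[lead g 0%MM])
     = descent_map (\sum_(j < n) expand (fun a => 'X_[theta_shift j a]) (k j)).
  rewrite !linear_sum /=; under [RHS]eq_bigr do rewrite -theta_expand -hE mulrC.
  rewrite -eq_h; apply: eq_bigr => g' g'G.
  by rewrite linearZ /= expandX descent_basis_lead // descent_prod0.
move/(expand_inj descent_basis_unitriangular)/(congr1 (mcoeff (lead g 0%MM))).
rewrite !linear_sum /= [RHS]big1 => [|j _].
  rewrite (bigD1 g) //= big1 ?addr0 => [|g' /andP[g'G neq_g]].
    by rewrite mcoeffZ mcoeffX eqxx mulr1.
  rewrite mcoeffZ mcoeffX; case: eqP => [|_]; last by rewrite mulr0.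
  by case/(lead_inj r_gt0 p_gt0 n_gt0 dvd_pr g'G gG) => eq_g; rewrite eq_g eqxx in neq_g.
apply: mcoeff_expand_shift => a; apply/eqP.
case/(lead_inj r_gt0 p_gt0 n_gt0 dvd_pr (index_Gamma a) gG) => _ /eqP.
by rewrite mnmD_eq0 mnm1_eq0 andbF.
Qed.

End Basis.

Theorem theorem4p3 (R : realType) (r p n : nat)
    (hr : (0 < r)%N) (hp : (0 < p)%N) (hn : (0 < n)%N) (hpr : (p %| r)%N) :
  is_basis (V := coinvariant R[i] r p n) (Gamma r p n)
    (fun g : colored_perm r n => coset_H r p (xmon R[i] g)).
Proof. by split; [apply: descent_lin_indep | apply: descent_spans]. Qed.
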